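(* For every integer $n\geq 1$, $$T(4,n) = G_n(4,1) + 10\,G_{n-1}(4,0) + 4\,G_{n-2}(5,0).$$
   Context: The Super-Catalan numbers are $T(m,n) := \frac{1}{2}\cdot\frac{(2m)!\,(2n)!}{m!\,n!\,(m+n)!}$ for integers $m\ge 0$, $n\geq 1$. A Dyck path of length $2\ell$ ($\ell\ge 0$) is a sequence $\pi=(\pi(1),\dots,\pi(2\ell))$ with each $\pi(k)=\pm1$, $\sum_{i=1}^{2\ell}\pi(i)=0$, and $\sum_{i=1}^k\pi(i)\ge 0$ for all $1\le k\le 2\ell$; its length is $|\pi|=2\ell$. Its height is $h(\pi)=\max_k\sum_{i=1}^k\pi(i)$, and the unique Dyck path $\epsilon$ of length $0$ has $h(\epsilon)=0$. For integers $m\ge 1$, $k\ge 0$ and $n$, $G_n(m,k)$ is the number of $m$-tuples $(\pi^{(1)},\dots,\pi^{(m)})$ of Dyck paths with $\sum_{i=1}^m|\pi^{(i)}|=2n$ and $|h(\pi^{(i)})-h(\pi^{(j)})|\le k$ for all $i,j$ (so $G_n(m,k)=0$ for $n<0$). *)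

(* Defs.v *)
From mathcomp Require Import all_boot all_order all_algebra.

Set Implicit Arguments.
Unset Strict Implicit.
Unset Printing Implicit Defensive.

Import Order.TTheory GRing.Theory Num.Theory.
Local Open Scope ring_scope.

Definition super_catalan (m n : nat) : rat :=
  2^-1 * (((2 * m)`! * (2 * n)`!)%:R / (m`! * n`! * (m + n)`!)%:R).

(* A path is encoded as its sequence of steps, [true] standing for +1 and
   [false] for -1. *)
Definition step (b : bool) : int := if b then 1 else -1.

Definition psum (p : seq bool) (k : nat) : int := \sum_(b <- take k p) step b.

(* The vanishing of the total sum forces [size p] to be even. *)
Definition is_dyck (p : seq bool) : bool :=
  (psum p (size p) == 0) && [forall k : 'I_(size p), 0 <= psum p k.+1].

(* The default value 0 is the height of the empty path; it does not affect the
   maximum for a nonempty Dyck path, whose last partial sum is 0. *)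
Definition height (p : seq bool) : int :=
  \big[Num.max/0]_(k < size p) psum p k.+1.

(* In a tuple of total length 2n every component has length at most 2n, so the
   tuples being counted all live in the finite type of tuples of sequences of
   length at most 2|n|. For n < 0 the length condition is unsatisfiable and
   the count is 0. *)
Definition G (n : int) (m k : nat) : nat :=
  #|[set p : m.-tuple ((2 * `|n|)%N.-bseq bool) |
     [&& [forall i, is_dyck (tnth p i)],
         \sum_(i < m) (size (tnth p i))%:Z == 2 * n
       & [forall i, forall j,
            `|height (tnth p i) - height (tnth p j)| <= k%:Z]]]|.

(* Main.v *)
Require Import Defs.
From mathcomp Require Import all_boot all_order all_algebra zify ring.
Import Order.TTheory GRing.Theory Num.Theory.
Local Open Scope ring_scope.

(* Let E_h(q) be the generating function, by half-length, of the Dyck paths of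
   height < h. Counting m-tuples by their minimal height h gives
     sum_n G_n(m,k) q^n
       = sum_h (E_{h+k+1} - E_h)^m - (E_{h+k+1} - E_{h+1})^m.
   Since E_{h+1} = 1 + q E_h E_{h+1}, the right-hand side of the theorem is
   q^-2 times a telescoping sum of polynomials in q, E_h and E_{h+1}, and its
   limit is expressed by the Catalan series E = 1 + q E^2: up to terms of degree
   at most 3 in q, q^3 times the sum is (4q - 1)^3 E. The coefficients of this
   series are T(4,n) = 64 C_n - 48 C_{n+1} + 12 C_{n+2} - C_{n+3}.
   Power series are replaced by polynomials modulo 'X^(N+1), where 'X marks a
   single step, so that q = 'X^2. *)

(** * Counting walks in a strip *)

(* The path [p] started at height [j] stays in [0, h) and ends at 0. *)
Fixpoint walk (h j : nat) (p : seq bool) : bool :=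
  (j < h)%N &&
  match p, j with
  | [::], _ => j == 0%N
  | true :: p', _ => walk h j.+1 p'
  | false :: p', j'.+1 => walk h j' p'
  | false :: _, 0 => false
  end.

Fixpoint nwalk (h j n : nat) : nat :=
  if (j < h)%N then
    match n, j with
    | 0, _ => nat_of_bool (j == 0%N)
    | n'.+1, j'.+1 => nwalk h j.+1 n' + nwalk h j' n'
    | n'.+1, 0 => nwalk h 1 n'
    end
  else 0.

Lemma nwalk_ge h j n : (h <= j)%N -> nwalk h j n = 0%N.
Proof. by move=> lehj; case: n => [|n] /=; rewrite ltnNge lehj. Qed.

Lemma sum_walk h j n : (\sum_(p : n.-tuple bool) walk h j p)%N = nwalk h j n.
Proof.
elim: n j => [|n IHn] j.
  rewrite (eq_bigr (fun _ => walk h j [::] : nat)) => [|p _]; last first.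
    by rewrite tuple0.
  by rewrite sum_nat_const card_tuple mul1n /=; case: ifP.
pose consp (x : bool * n.-tuple bool) := [tuple of x.1 :: x.2].
rewrite (reindex consp) /=; last first.
  exists (fun p => (thead p, [tuple of behead p])) => [[b p] _|p _].
    by rewrite /consp theadE; congr (_, _); apply: val_inj.
  by rewrite /consp /= -tuple_eta.
rewrite -(pair_bigA _
  (fun b (p : n.-tuple bool) => walk h j (b :: p) : nat)) big_bool /=.
case: ltnP => ltjh /=; last by rewrite !sum_nat_const !muln0.
by rewrite IHn; case: j ltjh => [|j] _; rewrite ?IHn //
   sum_nat_const muln0 addn0.
Qed.

(** In [n] steps from height [j] a walk rises at most to [j + n], so a higher ceiling is never
    felt. *)
Lemma nwalk_stable h h' j n :
  (j + n < h)%N -> (j + n < h')%N -> nwalk h j n = nwalk h' j n.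
Proof.
elim: n j => [|n IHn] j /= lth lth'.
  by rewrite addn0 in lth lth'; rewrite lth lth'.
have -> : (j < h)%N by lia.
have -> : (j < h')%N by lia.
by case: j lth lth' => [|j] lth lth'; rewrite !(IHn _.+1) ?(IHn j) //; lia.
Qed.

(** * Dyck paths of bounded height as walks in a strip *)

Lemma psum0 p : psum p 0 = 0.
Proof. by rewrite /psum take0 big_nil. Qed.

Lemma psum_cons b p k : psum (b :: p) k.+1 = step b + psum p k.
Proof. by rewrite /psum /= big_cons. Qed.

Lemma walkP h j p :
  reflect (j%:Z + psum p (size p) = 0 /\
           forall k, (k <= size p)%N -> 0 <= j%:Z + psum p k < h%:Z)
          (walk h j p).
Proof.
apply: (iffP idP).
  elim: p j => [|b p IHp] j /= /andP[ltjh].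
    by move=> /eqP->; rewrite psum0; split=> // -[] // _; rewrite psum0; lia.
  have stay j' : step b = j'%:Z - j%:Z -> walk h j' p ->
      j%:Z + psum (b :: p) (size p).+1 = 0 /\
      forall k, (k <= (size p).+1)%N -> 0 <= j%:Z + psum (b :: p) k < h%:Z.
    move=> stepE /IHp [end0 bnd]; rewrite psum_cons stepE; split; first lia.
    case=> [|k] lek; first by rewrite psum0; lia.
    by rewrite psum_cons stepE; have := bnd k lek; lia.
  by case: b stay => stay; [|case: j ltjh stay => [//|j] _ stay]; apply: stay;
     rewrite /step; lia.
elim: p j => [|b p IHp] j /= [end0 bnd].
  by have := bnd 0 isT; rewrite psum0 in end0 *; lia.
have := bnd 0 isT; rewrite psum0 addr0 => ltjh.
have := bnd 1 isT; rewrite psum_cons psum0 addr0 => bnd1.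
rewrite psum_cons in end0.
have go j' : step b = j'%:Z - j%:Z -> walk h j' p.
  move=> stepE; apply: IHp; split; first by move: end0; rewrite stepE; lia.
  by move=> k lek; have := bnd k.+1 lek; rewrite psum_cons stepE; lia.
apply/andP; split; first lia.
case: b {bnd end0 IHp} bnd1 go => bnd1 go.
  by apply: go; rewrite /step; lia.
case: j ltjh bnd1 go => [|j] ltjh bnd1 go.
  by move: bnd1; rewrite /step; lia.
by apply: go; rewrite /step; lia.
Qed.

Lemma height_ge0 p : 0 <= height p.
Proof.
by rewrite /height; elim/big_rec: _ => // i x _ x0; rewrite le_max x0 orbT.
Qed.

Lemma walk_height h p : walk h 0 p = is_dyck p && (height p < h%:Z).
Proof.
apply/walkP/andP => [[end0 bnd]|[/andP[/eqP end0 /forallP ge0] lth]].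
  rewrite add0r in end0; split.
    rewrite /is_dyck end0 eqxx; apply/forallP => k.
    by have /andP[] := bnd k.+1 (ltn_ord k); rewrite add0r.
  (* The default value 0 of the maximum must also lie below [h]; this is the bound at the empty
     prefix. *)
  apply/bigmax_ltP; split; first by have /andP[] := bnd 0 isT; rewrite psum0.
  by move=> k _; have /andP[] := bnd k.+1 (ltn_ord k); rewrite add0r.
rewrite add0r end0; split=> // -[_|k ltk]; rewrite add0r.
  by rewrite psum0 lexx (le_lt_trans _ lth) // height_ge0.
move/bigmax_ltP: lth => [_ lth].
by rewrite (ge0 (Ordinal ltk)) (lth (Ordinal ltk)).
Qed.

Lemma psum_le p k : psum p k <= k%:Z.
Proof.
elim: p k => [|b p IHp] [|k]; rewrite ?psum0 ?psum_cons //.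
  by rewrite /psum /= big_nil.
by have := IHp k; case: b; rewrite /step; lia.
Qed.

Lemma height_le_size p : height p <= (size p)%:Z.
Proof.
apply/bigmax_leP; split=> // k _; apply: le_trans (psum_le _ _) _.
by rewrite lez_nat.
Qed.

(** * Generating functions of tuples with close heights *)

Lemma sum_tnth_prod (R : comPzSemiRingType) (T : finType) m (F : T -> R) :
  \sum_(p : m.-tuple T) \prod_(i < m) F (tnth p i) = (\sum_x F x) ^+ m.
Proof.
rewrite -[in RHS](card_ord m) -prodr_const bigA_distr_bigA /=.
rewrite (reindex (fun f : {ffun 'I_m -> T} => [tuple f i | i < m])) /=.
  by apply: eq_bigr => f _; apply: eq_bigr => i _; rewrite tnth_mktuple.
exists (fun p : m.-tuple T => [ffun i => tnth p i]) => [f _|p _].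
  by apply/ffunP => i; rewrite ffunE tnth_mktuple.
by apply: eq_from_tnth => i; rewrite tnth_mktuple ffunE.
Qed.

(** The series E_h in the single-step variable, truncated to degree below [N]. *)
Definition below (N h : nat) : {poly rat} := \poly_(i < N) (nwalk h 0 i)%:R.

Lemma sum_below B h :
  \sum_(s : B.-bseq bool) (walk h 0 s)%:R *: 'X^(size s) = below B.+1 h.
Proof.
rewrite (reindex (@tagged_tuple_bseq B bool)) /=; last first.
  by apply: onW_bij; exact: tagged_tuple_bseq_bij.
pose F (k : 'I_B.+1) (s : k.-tuple bool) : {poly rat} :=
  (walk h 0 s)%:R *: 'X^(size s).
rewrite -(@sig_big_dep _ _ _ _ _ xpredT (fun _ => xpredT) F) /F.
rewrite /below poly_def; apply: eq_bigr => k _.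
rewrite -sum_walk natr_sum scaler_suml.
by apply: eq_bigr => s _; rewrite size_tuple.
Qed.

Lemma natrB_bool (A B : bool) : (B -> A) -> A%:R - B%:R = (A && ~~ B)%:R :> rat.
Proof. by case: A B => [] [] // H; rewrite ?subrr ?subr0 //; have := H isT. Qed.

(* The [h]-th term is nonzero only if [h] is the minimum of [x]. *)
Lemma sum_window m k H (x : 'I_m.+1 -> nat) : (forall i, (x i < H)%N) ->
  \sum_(h < H) ([forall i, h <= x i < h + k.+1]%N%:R
                - [forall i, h.+1 <= x i < h + k.+1]%N%:R) =
  [forall i, forall j, (x i <= x j + k)%N]%:R :> rat.
Proof.
move=> ltx; case: (arg_minnP x (erefl : xpredT (ord0 : 'I_m.+1))) => i0 _ minx.
pose h0 := Ordinal (ltx i0).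
rewrite (bigD1 h0) //= [X in _ + X]big1 ?addr0 => [|h neh].
  have -> : [forall i, x i0 < x i < x i0 + k.+1]%N = false.
    by apply/negbTE/forallPn; exists i0; rewrite ltnn.
  rewrite subr0; congr ((nat_of_bool _)%:R); apply/forallP/forallP => bnd i.
    by apply/forallP => j; have := minx j isT; have := bnd i; lia.
  by have := minx i isT; have /forallP/(_ i0) := bnd i; lia.
apply/eqP; rewrite subr_eq0; apply/eqP; congr ((nat_of_bool _)%:R).
have {}neh : (h != x i0 :> nat).
  by apply: contraNneq neh => e; apply/eqP/val_inj.
apply/forallP/forallP => bnd i; last by have := bnd i; lia.
by have := minx i isT; have := bnd i; have := bnd i0; lia.
Qed.

Lemma natr_forall (R : comPzSemiRingType) m (P : pred 'I_m) :
  [forall i, P i]%:R = \prod_(i < m) (P i)%:R :> R.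
Proof.
have [/forallP allP|/forallPn[i /negbTE nPi]] := boolP [forall i, P i].
  by rewrite big1 // => i _; rewrite allP.
by rewrite (bigD1 i) //= nPi mul0r.
Qed.

(** For one path, height in [a, b) is height below b minus height below a; distributivity then gives
    the power for tuples. *)
Lemma sum_heights m B (a b : nat) : (a <= b)%N ->
  \sum_(p : m.-tuple (B.-bseq bool))
     [forall i, is_dyck (tnth p i) && (a%:Z <= height (tnth p i) < b%:Z)]%:R
       *: 'X^(\sum_(i < m) size (tnth p i)) =
  (below B.+1 b - below B.+1 a) ^+ m.
Proof.
move=> leab; rewrite -!sum_below -sumrB -sum_tnth_prod; apply: eq_bigr => p _.
rewrite natr_forall -prodrXr -scaler_prod; apply: eq_bigr => i _.
rewrite -scalerBl !walk_height natrB_bool => [|/andP[-> /=]]; last by lia.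
by congr (_%:R *: _); case: is_dyck => //=; lia.
Qed.

(** Exchanging the sums leaves, for each tuple, the window indicators of [sum_window]. All heights
    are at most [2 * n < H], so every possible minimum is among the summed [h]. *)
Lemma G_coef (H n m k : nat) (E := below (2 * n).+1) : (2 * n < H)%N ->
  (G n%:Z m.+1 k)%:R =
  (\sum_(h < H) ((E (h + k.+1)%N - E h) ^+ m.+1
                 - (E (h + k.+1)%N - E h.+1) ^+ m.+1))`_(2 * n).
Proof.
move=> ltnH; rewrite /E.
under eq_bigr => h _.
  rewrite -!sum_heights ?leq_addr //; last by lia.
  rewrite -sumrB; under eq_bigr => p _ do rewrite -scalerBl.
  over.
rewrite exchange_big coef_sum /G -sum1_card natr_sum big_mkcond /=.
apply: eq_bigr => p _; rewrite -scaler_suml coefZ coefXn inE mulr1n.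
set sz := (_ == 2 * n%:Z).
have -> : (2 * n == \sum_(i < m.+1) size (tnth p i))%N = sz.
  by rewrite /sz -(big_morph Posz PoszD (erefl _)) -PoszM eqz_nat eq_sym.
case: sz; rewrite ?mulr0 ?andbF //= mulr1.
have [/forallP dyck|/forallPn[i ndyck]] := boolP [forall i, is_dyck (tnth p i)];
  last first.
  rewrite big1 // => h _; apply/eqP; rewrite subr_eq0; apply/eqP.
  by congr ((nat_of_bool _)%:R); apply/forallP/forallP => /(_ i);
     rewrite (negbTE ndyck).
pose x i := `|height (tnth p i)|%N.
have xE i : height (tnth p i) = x i by rewrite /x gez0_abs // height_ge0.
have ltx i : (x i < H)%N.
  apply: leq_ltn_trans ltnH; rewrite -lez_nat -xE.
  by rewrite (le_trans (height_le_size _)) // lez_nat size_bseq.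
have -> : [forall i, forall j,
    `|height (tnth p i) - height (tnth p j)| <= k%:Z] =
  [forall i, forall j, (x i <= x j + k)%N].
  apply/forallP/forallP => bnd i; apply/forallP => j.
    by have /forallP/(_ j) := bnd i; rewrite !xE; lia.
  have /forallP/(_ j) := bnd i; have /forallP/(_ i) := bnd j; rewrite !xE; lia.
rewrite -mulrb -(sum_window _ k _ x ltx); apply: eq_bigr => h _.
by congr (_%:R - _%:R); congr nat_of_bool; apply: eq_forallb => i;
   rewrite dyck xE !lez_nat !ltz_nat.
Qed.

(** * Truncated power series as a quotient ring *)

Lemma coef_in_qpolyXn (R : nzRingType) N (p : {poly R}) i :
  (in_qpoly 'X^(N.+1) p : {poly R})`_i = if (i < N.+1)%N then p`_i else 0.
Proof.
rewrite -coef_take_poly /= mk_monic_Xn /= -[p in LHS](poly_take_drop N.+1) addrC.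
rewrite Pdiv.RingMonic.rmodp_addl_mul_small ?monicXn //.
by rewrite size_polyXn ltnS size_take_poly.
Qed.

Lemma eq_in_qpolyXn (R : nzRingType) N (p r : {poly R}) :
  in_qpoly 'X^(N.+1) p = in_qpoly 'X^(N.+1) r <->
  forall i, (i <= N)%N -> p`_i = r`_i.
Proof.
split=> [eqpr i leiN|eqpr].
  by have := congr1 (fun x : {poly _ } => x`_i) (congr1 val eqpr);
     rewrite !coef_in_qpolyXn ltnS leiN.
apply/val_inj/polyP => i; rewrite !coef_in_qpolyXn ltnS.
by case: leqP => // /eqpr.
Qed.

Lemma in_qpoly_below N M h : (N < M)%N ->
  in_qpoly 'X^(N.+1) (below M h) = in_qpoly 'X^(N.+1) (below N.+1 h).
Proof.
move=> ltNM; apply/eq_in_qpolyXn => i leiN.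
by rewrite !coef_poly ltnS leiN (leq_ltn_trans leiN).
Qed.

(** The bounds [M] and [H] do not depend on [n], so one choice serves all three counts of the
    theorem. *)
Definition spread_poly (M H m k : nat) : {poly rat} :=
  \sum_(h < H) ((below M (h + k.+1) - below M h) ^+ m
                - (below M (h + k.+1) - below M h.+1) ^+ m).

Lemma coef_spread_poly (M H n m k : nat) : (2 * n < M)%N -> (2 * n < H)%N ->
  (spread_poly M H m.+1 k)`_(2 * n) = (G n%:Z m.+1 k)%:R.
Proof.
move=> ltnM ltnH; rewrite (G_coef H) //.
apply: (iffLR (eq_in_qpolyXn _ _ _ _)) (leqnn _).
rewrite !rmorph_sum; apply: eq_bigr => h _.
by rewrite !rmorphB !rmorphXn !rmorphB /= !(in_qpoly_below _ M).
Qed.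

(** * The recurrence in the height bound *)

Section Recurrence.

Variable N : nat.
Local Notation Q := {poly %/ ('X^(N.+1) : {poly rat})}.
Local Notation t := (in_qpoly ('X^(N.+1) : {poly rat}) 'X).

Definition walks (h j : nat) : Q :=
  in_qpoly 'X^(N.+1) (\poly_(i < N.+1) (nwalk h j i)%:R).

Lemma expt : t ^+ N.+1 = 0.
Proof.
rewrite -rmorphXn -[RHS](rmorph0 (in_qpoly ('X^(N.+1) : {poly rat}))).
by apply/eq_in_qpolyXn => i leiN; rewrite coefXn coef0 ltn_eqF.
Qed.

Lemma walks_ge h j : (h <= j)%N -> walks h j = 0.
Proof.
move=> lehj; rewrite -[RHS](rmorph0 (in_qpoly ('X^(N.+1) : {poly rat}))).
by apply/eq_in_qpolyXn => i _; rewrite coef_poly coef0 nwalk_ge // if_same.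
Qed.

Lemma walks0 h : walks h.+1 0 = 1 + t * walks h.+1 1.
Proof.
rewrite /walks -(rmorph1 (in_qpoly ('X^(N.+1) : {poly rat}))) -rmorphM -rmorphD.
apply/eq_in_qpolyXn => i leiN; rewrite coefD coef1 coefXM !coef_poly ltnS leiN.
by case: i leiN => [|i] leiN /=; rewrite ?addr0 // add0r (leqW leiN).
Qed.

Lemma walksS h j : (j.+1 < h)%N ->
  walks h j.+1 = t * (walks h j.+2 + walks h j).
Proof.
move=> ltjh; rewrite /walks -rmorphD -rmorphM.
apply/eq_in_qpolyXn => i leiN; rewrite coefXM coefD !coef_poly ltnS leiN.
by case: i leiN => [|i] leiN /=; rewrite ltjh // (leqW leiN) natrD.
Qed.

(* The formula comes from cutting a path at its first visit to 0. Both sides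
   satisfy the same linear recurrence in [j], so their difference is divisible by
   every power of the nilpotent [t]. *)
Lemma walks_first_passage h j :
  walks h.+1 j.+1 = t * walks h j * walks h.+1 0.
Proof.
pose D j := walks h.+1 j.+1 - t * walks h j * walks h.+1 0.
have D0 : (0 < h)%N -> D 0 = t * D 1.
  case: h @D => // h D _; rewrite /D walksS // (walks0 h); ring.
have DS i : (i.+1 < h)%N -> D i.+1 = t * (D i.+2 + D i).
  by move=> ltih; rewrite /D walksS // (walksS h) //; ring.
have Dge i : (h <= i)%N -> D i = 0.
  move=> lehi; rewrite /D (walks_ge h.+1) // (walks_ge h) //.
  by rewrite mulr0 mul0r subr0.
suff /(_ N.+1 j)[r] : forall k i, exists r, D i = t ^+ k * r.
  by rewrite expt mul0r => /eqP; rewrite subr_eq0 => /eqP.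
elim=> [|k IHk] i; first by exists (D i); rewrite expr0 mul1r.
have [/Dge->|] := leqP h i; first by exists 0; rewrite mulr0.
case: i => [/D0->|i /DS->].
  by have [r ->] := IHk 1; exists r; rewrite (exprS t) mulrA.
have [r ->] := IHk i.+2; have [s ->] := IHk i; exists (r + s).
by rewrite (exprS t) -mulrDr mulrA.
Qed.

(** First-return decomposition: [t ^+ 2] accounts for the first up step and the down step back to 0,
    between which the strip is one lower. *)
Lemma walks_rec h : walks h.+1 0 = 1 + t ^+ 2 * walks h 0 * walks h.+1 0.
Proof. by rewrite {1}walks0 walks_first_passage; ring. Qed.

End Recurrence.

(** * The telescoping identity *)

Section Telescoping.

Variables (R : comNzRingType) (q : R).

(** With a, b, c = E_h, E_{h+1}, E_{h+2}, this is the h-th term of the right-hand side; for k = 0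
    the subtracted power vanishes. *)
Definition summand (a b c : R) : R :=
  (c - a) ^+ 4 - (c - b) ^+ 4 + 10 * q * (b - a) ^+ 4
  + 4 * q ^+ 2 * (b - a) ^+ 5.

(* Found by linear algebra over the monomials q^l a^i and q^l b^j; the
   coefficients of [r1] and [r2] in [summand_primitive] below come from
   polynomial division. *)
Definition primitive (a b : R) : R :=
  - (24 * q * a) + 60 * q ^+ 2 * a - 30 * q ^+ 2 * a ^+ 2 + 4 * q ^+ 2 * a ^+ 3
  + 20 * q ^+ 3 * a ^+ 3 - q ^+ 2 * a ^+ 4 - 10 * q ^+ 3 * a ^+ 4
  + 4 * q ^+ 4 * a ^+ 5 + 24 * b - 24 * q * b + 20 * q ^+ 2 * b
  - 16 * q * b ^+ 2 + 10 * q ^+ 2 * b ^+ 2 + 4 * q ^+ 2 * b ^+ 3.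

(** The two recurrences say that [r1] and [r2] vanish, and the difference of the sides lies in the
    ideal they generate. *)
Lemma summand_primitive a b c : b = 1 + q * a * b -> c = 1 + q * b * c ->
  q ^+ 2 * summand a b c = primitive b c - primitive a b.
Proof.
move=> eb ec.
pose r1 := q * a * b - b + 1; pose r2 := q * b * c - c + 1.
have r1_0 : r1 = 0 by rewrite /r1 {2}eb; ring.
have r2_0 : r2 = 0 by rewrite /r2 {2}ec; ring.
apply/eqP; rewrite -subr_eq0; apply/eqP.
rewrite (_ : _ - _ =
  (- 20 - 4 * c + 20 * q + 10 * q * c + 6 * q * c ^+ 2 + 20 * q * b
   - 20 * q * a - 4 * q * a * c - 40 * q ^+ 2 * b + 40 * q ^+ 2 * a
   + 20 * q ^+ 2 * a * b - 20 * q ^+ 2 * a ^+ 2 - 20 * q ^+ 3 * b ^+ 3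
   + 40 * q ^+ 3 * a * b ^+ 2 - 40 * q ^+ 3 * a ^+ 2 * b
   + 20 * q ^+ 3 * a ^+ 3) * r1
  + (20 + 4 * b - 20 * q - 10 * q * c - 6 * q * b * c + 4 * q * b ^+ 2) * r2
  + (4 * q - 20 * q ^+ 2 - 10 * q ^+ 2 * c - 4 * q ^+ 2 * c ^+ 2
     + 10 * q ^+ 2 * a + 6 * q ^+ 2 * a * c - 4 * q ^+ 2 * a ^+ 2)
    * (c * r1 - a * r2)).
  by rewrite r1_0 r2_0 !(mulr0, subr0, addr0).
by rewrite /r1 /r2 /summand /primitive; ring.
Qed.

(** Evaluates the ends of the telescope: the lower one is (E_0, E_1) = (0, 1), the upper one the
    fixed point of the recurrence. *)
Lemma primitive_diag b : b = 1 + q * b ^+ 2 ->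
  q * (primitive b b - primitive 0 1) =
  (4 * q - 1) ^+ 3 * b + (1 - 11 * q + 38 * q ^+ 2 - 34 * q ^+ 3).
Proof.
move=> eb.
pose r := q * b * b - b + 1.
have r_0 : r = 0 by rewrite /r {3}eb; ring.
apply/eqP; rewrite -subr_eq0; apply/eqP.
rewrite (_ : _ - _ =
  (- 1 - 13 * q - q * b + 2 * q ^+ 2 + 2 * q ^+ 2 * b - q ^+ 2 * b ^+ 2
   + 16 * q ^+ 3 * b - 6 * q ^+ 3 * b ^+ 2 + 4 * q ^+ 4 * b ^+ 3) * r).
  by rewrite r_0 mulr0.
by rewrite /r /primitive; ring.
Qed.

Lemma sum_summand (x : nat -> R) n :
    x 0%N = 0 -> (forall h, x h.+1 = 1 + q * x h * x h.+1) -> x n.+1 = x n ->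
  q ^+ 3 * (\sum_(h < n) summand (x h) (x h.+1) (x h.+2)) =
  (4 * q - 1) ^+ 3 * x n + (1 - 11 * q + 38 * q ^+ 2 - 34 * q ^+ 3).
Proof.
move=> x0 xS xn.
rewrite exprS -mulrA mulr_sumr -primitive_diag; last first.
  (* Stationarity at [n] turns the recurrence into the fixed-point equation. *)
  by rewrite -{1}xn xS xn expr2 mulrA.
under eq_bigr => h _ do rewrite summand_primitive //.
rewrite -(big_mkord xpredT
  (fun h => primitive (x h.+1) (x h.+2) - primitive (x h) (x h.+1))).
rewrite telescope_sumr // xn x0; congr (q * (_ - primitive _ _)).
by rewrite xS x0 mulr0 mul0r addr0.
Qed.

End Telescoping.

(** Serves for truncated polynomials, whose recurrence holds only after reduction by [f]. *)
Lemma rmorph_sum_summand (A B : comNzRingType) (f : {rmorphism A -> B}) (q : A)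
    (x : nat -> A) n :
    f (x 0%N) = 0 ->
    (forall h, f (x h.+1) = 1 + f q * f (x h) * f (x h.+1)) ->
    f (x n.+1) = f (x n) ->
  f (q ^+ 3 * (\sum_(h < n) summand _ q (x h) (x h.+1) (x h.+2))) =
  f ((4 * q - 1) ^+ 3 * x n + (1 - 11 * q + 38 * q ^+ 2 - 34 * q ^+ 3)).
Proof.
move=> x0 xS xn; rewrite rmorphM rmorphXn rmorph_sum /=.
under eq_bigr => h _.
  have -> : f (summand _ q (x h) (x h.+1) (x h.+2)) =
      summand _ (f q) (f (x h)) (f (x h.+1)) (f (x h.+2)).
    by rewrite /summand; ring.
  over.
by rewrite (sum_summand _ _ (f \o x)) //=; ring.
Qed.

(** * Catalan and super-Catalan coefficients *)

Lemma fact_neq0 (R : numDomainType) n : n`!%:R != 0 :> R.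
Proof. by rewrite pnatr_eq0 -lt0n fact_gt0. Qed.

(* These are the ballot numbers; p^(k+1) = p^k + X^2 p^(k+2) gives their
   recurrence. *)
Lemma series_expr_coef (N : nat) (p : {poly rat}) (k i : nat) :
    (forall j, (j <= N)%N -> p`_j = (1 + 'X^2 * p ^+ 2)`_j) -> (2 * i <= N)%N ->
  (p ^+ k.+1)`_(2 * i) = (k.+1 * (2 * i + k)`!)%:R / (i`! * (i + k.+1)`!)%:R.
Proof.
move=> prec.
have eXp j m : (j <= N)%N ->
    (p ^+ m.+1)`_j = (p ^+ m)`_j + ('X^2 * p ^+ m.+2)`_j.
  have -> : 'X^2 * p ^+ m.+2 = ('X^2 * p ^+ 2) * p ^+ m.
    by rewrite -mulrA -exprD.
  move=> lejN; rewrite -coefD -[X in X + _]mul1r -mulrDl exprS.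
  rewrite !coefM; apply: eq_bigr => s _.
  by rewrite prec // (leq_trans _ lejN) // -ltnS.
elim: i k => [|i IHi] k.
  have p0 : p.[0] = 1 by rewrite horner_coef0 prec // coefD coef1 coefXnM addr0.
  move=> _; rewrite muln0 -horner_coef0 horner_exp p0 expr1n !add0n mul1n.
  by rewrite -factS divff // pnatr_eq0 -lt0n fact_gt0.
move=> leiN; have leiN' : (2 * i <= N)%N by lia.
have step m : (p ^+ m.+1)`_(2 * i.+1) =
    (p ^+ m)`_(2 * i.+1) + (p ^+ m.+2)`_(2 * i).
  by rewrite eXp // mulnS coefXnM ltnNge leq_addr addKn.
(* Allowing the exponent [m = 0], where both sides vanish, gives the inner induction its base. *)
suff -> m : (p ^+ m)`_(2 * i.+1) =
    (m * (2 * i + m).+1`!)%:R / (i.+1`! * (i + m).+1`!)%:R.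
  by rewrite mulnS addnS add2n !addSn addnS.
elim: m => [|m IHm]; first by rewrite expr0 coef1 mul0r.
rewrite step IHm IHi // !addnS.
rewrite (factS (2 * i + m).+1) (factS (i + m).+1) (factS i).
set A := (2 * i + m).+1`!; set B := i`!; set D := (i + m).+1`!.
have := fact_neq0 rat i; have := fact_neq0 rat (i + m).+1.
rewrite -/A -/B -/D => D_nz B_nz.
have i_nz : i.+1%:R != 0 :> rat by rewrite pnatr_eq0.
have im_nz : (i + m).+2%:R != 0 :> rat by rewrite pnatr_eq0.
clearbody A B D; move: i_nz im_nz; rewrite !natrM -!natr1 !natrD.
move: A%:R B%:R D%:R D_nz B_nz => {}A {}B {}D D_nz B_nz i_nz im_nz.
by field; rewrite D_nz B_nz i_nz im_nz.
Qed.

Definition catalan (i : nat) : rat := (2 * i)`!%:R / (i`! * i.+1`!)%:R.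

(** The weights are the coefficients of (4q - 1)^3. Once all factorials are reduced to (2n)! and n!,
    a rational identity in n remains. *)
Lemma super_catalan4 n : super_catalan 4 n =
  64 * catalan n - 48 * catalan n.+1 + 12 * catalan n.+2 - catalan n.+3.
Proof.
rewrite /super_catalan /catalan.
have -> : (2 * n.+1 = (2 * n).+2)%N by lia.
have -> : (2 * n.+2 = (2 * n).+4)%N by lia.
have -> : (2 * n.+3 = (2 * n).+4.+2)%N by lia.
rewrite add4n -[(2 * 4)%N]/8%N.
rewrite !factS; have := fact_neq0 rat n; set A := (2 * n)`!; set B := n`!.
clearbody A B => B_nz.
rewrite !natrM -!natr1 !natrD.
by field; rewrite B_nz !natr1 !pnatr_eq0.
Qed.

(** * Comparison of coefficients *)

Lemma below_stable M h h' : (M <= h)%N -> (M <= h')%N -> below M h = below M h'.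
Proof.
move=> leMh leMh'; apply/polyP => i; rewrite !coef_poly; case: ltnP => // ltiM.
by rewrite (nwalk_stable h h') // add0n (leq_trans ltiM).
Qed.

Lemma coef_below_catalan N i : (2 * i <= N)%N ->
  (below N.+1 N.+1)`_(2 * i) = catalan i.
Proof.
move=> leiN; rewrite -[below _ _]expr1 (series_expr_coef N) // => [|j lejN].
  by rewrite mul1n addn0 addn1.
apply: (iffLR (eq_in_qpolyXn _ _ _ _)) lejN.
rewrite rmorphD rmorphM !rmorphXn rmorph1 /=.
(* Heights [N.+1] and [N.+2] give the same truncation, so the recurrence between them becomes the
   Catalan equation. *)
rewrite [in LHS](below_stable N.+1 N.+1 N.+2) //.
have := walks_rec N N.+1; rewrite /walks.
rewrite -!/(below _ _) -(below_stable N.+1 N.+1 N.+2) // => {1}->.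
by rewrite expr2 mulrA.
Qed.

Lemma spread_poly_summand M H (x := below M) (q : {poly rat} := 'X^2) :
  spread_poly M H 4 1 + 10 * q * spread_poly M H 4 0
    + 4 * q ^+ 2 * spread_poly M H 5 0 =
  \sum_(h < H) summand _ q (x h) (x h.+1) (x h.+2).
Proof.
rewrite !mulr_sumr -!big_split; apply: eq_bigr => h _ /=.
by rewrite !addn1 addn2 !subrr /summand /x; ring.
Qed.

Lemma spread_poly_series N (q : {poly rat} := 'X^2) i : (i <= N)%N ->
  (q ^+ 3 * (spread_poly N.+1 N.+1 4 1 + 10 * q * spread_poly N.+1 N.+1 4 0
     + 4 * q ^+ 2 * spread_poly N.+1 N.+1 5 0))`_i =
  ((4 * q - 1) ^+ 3 * below N.+1 N.+1
     + (1 - 11 * q + 38 * q ^+ 2 - 34 * q ^+ 3))`_i.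
Proof.
move: i; apply/eq_in_qpolyXn.
rewrite spread_poly_summand.
apply: (rmorph_sum_summand _ _ (in_qpoly ('X^(N.+1) : {poly rat}))).
- exact: walks_ge.
- by move=> h; rewrite rmorphXn; exact: walks_rec.
- by congr in_qpoly; exact: below_stable.
Qed.

Theorem theorem2 (n : nat) (n_ge1 : (1 <= n)%N) :
  super_catalan 4 n =
    (G n%:Z 4 1 + 10 * G (n%:Z - 1) 4 0 + 4 * G (n%:Z - 2) 5 0)%N%:R.
Proof.
(* The factor q^3 is ['X^6], which moves degree [2 * n] to [6 + 2 * n]. *)
have [N NE] : exists N, N = (6 + 2 * n)%N by exists (6 + 2 * n)%N.
have predE (p : {poly rat}) : ('X^2 * p)`_(2 * n) = p`_(2 * n.-1).
  by have -> : (2 * n = 2 + 2 * n.-1)%N; [lia | rewrite coefXnM addKn].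
have shiftE (p : {poly rat}) : ('X^6 * p)`_N = p`_(2 * n).
  by rewrite NE coefXnM ltnNge leq_addr addKn.
have G41 : (spread_poly N.+1 N.+1 4 1)`_(2 * n) = (G n%:Z 4 1)%:R.
  by rewrite coef_spread_poly //; lia.
have G40 : (spread_poly N.+1 N.+1 4 0)`_(2 * n.-1) = (G (n%:Z - 1) 4 0)%:R.
  rewrite coef_spread_poly; try lia.
  by congr ((G _ _ _)%:R); lia.
have G50 :
    ('X^2 * spread_poly N.+1 N.+1 5 0)`_(2 * n.-1) = (G (n%:Z - 2) 5 0)%:R.
  rewrite coefXnM; case: n n_ge1 NE {predE shiftE G41 G40} => [|[|n]] // _ NE.
    (* For n = 1 the factor ['X^2] kills the constant coefficient, and no tuple has total length
       -2. *)
    rewrite /G /= eq_card0 // => p; rewrite !inE; apply/negbTE.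
    rewrite negb_and; apply/orP; right; rewrite negb_and; apply/orP; left.
    by rewrite -(big_morph Posz PoszD (erefl _)); lia.
  rewrite /= mulnS addKn coef_spread_poly; try lia.
  by congr ((G _ _ _)%:R); lia.
have catE k i : (k + 2 * i = N)%N -> ('X^k * below N.+1 N.+1)`_N = catalan i.
  move=> eN; rewrite coefXnM -eN ltnNge leq_addr addKn coef_below_catalan //.
  exact: leq_addl.
(* The correction polynomial has degree at most 6 in ['X], below [N] because n is at least 1. *)
have XE k : (k <= 6)%N -> ('X^k)`_N = 0 :> rat.
  by move=> lek; rewrite coefXn gtn_eqF //; lia.
have := spread_poly_series N N (leqnn _).
rewrite [X in nth _ (polyseq X) _ = _](_ : _ = 'X^6 *
  (spread_poly N.+1 N.+1 4 1 + 10%:P * ('X^2 * spread_poly N.+1 N.+1 4 0)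
   + 4%:P * ('X^2 * ('X^2 * spread_poly N.+1 N.+1 5 0)))); last by ring.
set P := below _ _ in catE *.
rewrite [X in _ = nth _ (polyseq X) _](_ : _ =
  64%:P * ('X^6 * P) - 48%:P * ('X^4 * P) + 12%:P * ('X^2 * P) - P
  + (1 - 11%:P * 'X^2 + 38%:P * 'X^4 - 34%:P * 'X^6)); last by ring.
rewrite shiftE !(coefD, coefB, coefN, coefCM).
rewrite !predE G41 G40 G50.
have c0 := catE 6 n (esym NE).
have c1 : ('X^4 * P)`_N = catalan n.+1 by apply: catE; lia.
have c2 : ('X^2 * P)`_N = catalan n.+2 by apply: catE; lia.
have c3 : P`_N = catalan n.+3 by rewrite -[P]mul1r; apply: (catE 0); lia.
rewrite c0 c1 c2 c3 (XE 0 isT) (XE 2 isT) (XE 4 isT) (XE 6 isT).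
rewrite !(mulr0, subr0, addr0) => eqN.
by rewrite natrD natrD natrM natrM super_catalan4 -eqN.
Qed.
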